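(* Let $G$ be a finite graph and let $n\le 2$ be an integer. Let $\mathcal{C}_n(G)=(C_n^i(G),d^i)_{0\le i\le m}$ be the graded chain complex defined in the context. Then its graded Euler characteristic is equal to the $n$-specialization of the dichromatic polynomial of $G$: $$\chi_q(\mathcal{C}_n(G))=P_{G,n}(q),$$ where $P_{G,n}(q)=P_G\big(q,\tfrac{q^n}{q-1}\big)$ is expanded as a series in $q^{-1}$ via $\tfrac{q^n}{q-1}=q^{n-1}\sum_{i\ge 0}q^{-i}$.
   Context: Graphs are finite, loops and multiple edges being allowed. For a graph $G$ with vertex set $V(G)$ and edge set $E(G)$ and $s\subset E(G)$, let $[G:s]$ be the graph with vertex set $V(G)$ and edge set $s$, and let $k(s)$ be its number of connected components. The dichromatic polynomial $P_G(q,v)$ is determined by $P_G=P_{G-e}-qP_{G/e}$ for every edge $e$ (deletion and contraction), and $P_{N_k}=v^k$ for the graph $N_k$ with $k$ vertices and no edges; equivalently $P_G(q,v)=\sum_{s\subset E(G)}(-1)^{|s|}q^{|s|}v^{k(s)}$. Graded modules. For a $\mathbb{Z}$-graded $\mathbb{Z}$-module $M=\bigoplus_k M_k$, the graded dimension is $q\dim M=\sum_k q^k\,\mathrm{rank}(M_k)$ with $\mathrm{rank}(M_k)=\dim_{\mathbb{Q}}(M_k\otimes\mathbb{Q})$. The shift $M\{l\}$ is defined by $M\{l\}_k=M_{k-l}$ (all degrees are increased by $l$). The graded Euler characteristic of a graded chain complex $\mathcal C$ with chain groups in positions $0\le i\le m$ is $\chi_q(\mathcal C)=\sum_{0\le i\le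 m}(-1)^i q\dim(H^i)$, where $H^i$ are the homology groups. The complex $\mathcal{C}_n(G)$, $n\le 2$. Let $G$ have $m$ edges, ordered $e_1,\dots,e_m$, and order its vertices, the $i$-th vertex having index $i$. For $\epsilon=(\epsilon_1,\dots,\epsilon_m)\in\{0,1\}^m$ let $G_\epsilon=[G:s_\epsilon]$ with $s_\epsilon=\{e_i:\epsilon_i=1\}$, and let $|\epsilon|=\sum_i\epsilon_i$. Let $K_1,\dots,K_l$ be the connected components of $G_\epsilon$ and let $i_j$ be the smallest index of a vertex in $K_j$. Put $M_\epsilon=\mathbb{Z}[x_{i_1},\dots,x_{i_l}]\{l(n-1)+|\epsilon|\}$, where each variable has degree $-1$ before the shift. The chain groups are $C_n^i(G)=\bigoplus_{|\epsilon|=i}M_\epsilon$. Per-edge maps: let $\epsilon$ have $\epsilon_j=0$ and let $\epsilon^+$ be obtained from $\epsilon$ by changing $\epsilon_j$ to $1$ (i.e. adding edge $e_j$). Denote by $\xi$ the tuple obtained from $\epsilon$ by replacing $\epsilon_j$ by the symbol $\ast$. The map $d_\xi:M_\epsilon\to M_{\epsilon^+}$ is defined as follows. (1) If $e_j$ has both ends in one component $K_p$ of $G_\epsilon$, $d_\xi$ is multiplication by $x_{i_p}$. (2) If $e_j$ joins two distinct components $K_p,K_q$ of $G_\epsilon$ with $i_p<i_q$, $d_\xi$ is the linear map that sends the monomial $\prod_{j'=1}^{l}x_{i_{j'}}^{a_{j'}}$ to $\prod_{j'\neq q}x_{i_{j'}}^{b_{j'}}$, with $b_{j'}=a_{j'}$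 for $j'\ne p$ and $b_p=a_p+a_q+2-n$ (that is, substitute $x_{i_q}=x_{i_p}$ and multiply by $x_{i_p}^{2-n}$). The differential $d^i:C_n^i(G)\to C_n^{i+1}(G)$ is $d^i=\sum_{|\xi|=i}(-1)^{\xi}d_\xi$, the sum being over all $m$-tuples $\xi$ of $0$'s, $1$'s and exactly one $\ast$ with $|\xi|=i$, where $|\xi|$ is the number of $1$'s in $\xi$, and $(-1)^\xi$ is $-1$ if there is an odd number of $1$'s before $\ast$ in $\xi$ and $+1$ otherwise ($d_\xi$ is extended by zero to the other summands). The maps $d^i$ preserve degree and satisfy $d^{i+1}\circ d^i=0$. *)

(* Defs.v *)
From HB Require Import structures.
From mathcomp Require Import all_boot all_order all_algebra.
From mathcomp Require Import boolp classical_sets fsbigop.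
From mathcomp Require Import mpoly.

Set Implicit Arguments.
Unset Strict Implicit.
Unset Printing Implicit Defensive.

Import GRing.Theory.
Local Open Scope ring_scope.

(* Finite multigraphs with ordered vertices and ordered edges; loops and
   parallel edges are allowed.  The order in which [ends] lists the two ends
   of an edge plays no role. *)
Record graph := Graph {
  nv : nat;
  ne : nat;
  ends : 'I_ne -> 'I_nv * 'I_nv }.

Section SpanningSubgraphs.
Variable G : graph.
Implicit Types (s : {set 'I_(ne G)}) (x y : 'I_(nv G)).

Definition adj s : rel 'I_(nv G) :=
  fun x y => [exists e in s, (ends e == (x, y)) || (ends e == (y, x))].

Definition ncomp s : nat := n_comp (adj s) predT.

(* The vertex of smallest index in the component of [x] in [G : s]. *)
Definition cmin s x : 'I_(nv G) :=
  [arg min_(y < x | connect (adj s) x y) (y : nat)].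

(* The outer variable is [v], the inner one is [q]. *)
Definition dichromatic : {poly {poly int}} :=
  \sum_(s : {set 'I_(ne G)}) ((-1) ^+ #|s| * 'X^#|s|)%:P * 'X^(ncomp s).

End SpanningSubgraphs.

(* Formal Laurent series in q^-1 with integer coefficients: [f k] is the
   coefficient of q^k, and [f] vanishes on all large enough [k]. *)
Definition qseries := int -> int.

(* For series as above the sum has finite support. *)
Definition qmul (f g : qseries) : qseries :=
  fun k => \sum_(i \in [set: int]) f i * g (k - i).

Definition qone : qseries := fun k => (k == 0)%:R.

Definition qexp (f : qseries) (j : nat) : qseries := iter j (qmul f) qone.

Definition qvar : qseries := fun k => (k == 1)%:R.

(* q^n / (q - 1) = q^(n-1) * \sum_(i >= 0) q^(-i) *)
Definition qn_over_q_sub1 (n : int) : qseries := fun k => (k <= n - 1)%R%:R.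

(* Value of P(q, v) (outer variable [v]) at the series q := a and v := b. *)
Definition eval_series (P : {poly {poly int}}) (a b : qseries) : qseries :=
  fun k => \sum_(j < size P) \sum_(i < size P`_j)
             P`_j`_i * qmul (qexp a i) (qexp b j) k.

Definition dichromatic_spec (G : graph) (n : int) : qseries :=
  eval_series (dichromatic G) qvar (qn_over_q_sub1 n).

Definition biadditive (M N W : zmodType) (f : M -> N -> W) : Prop :=
  (forall y, zmod_morphism (f^~ y)) /\ (forall x, zmod_morphism (f x)).

(* [t : M -> rat -> T] is a tensor product of [M] and [rat] over the integers,
   the rational structure of [T] being the one coming from the factor [rat]. *)
Record is_tensor_rat (M : zmodType) (T : lmodType rat) (t : M -> rat -> T) :
    Prop := IsTensorRat {
  tensor_biadditive : biadditive t;
  tensor_scale : forall x a b, a *: t x b = t x (a * b);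
  tensor_universal : forall (W : zmodType) (f : M -> rat -> W), biadditive f ->
    exists! g : T -> W, zmod_morphism g /\ forall x a, g (t x a) = f x a }.

Definition has_rank (M : zmodType) (r : nat) : Prop :=
  exists (T : vectType rat) (t : M -> rat -> T),
    is_tensor_rat t /\ \dim {:T} = r.

Definition finite_rank (M : zmodType) : Prop := exists r, has_rank M r.

(* Equal to 0 if M does not have finite rank. *)
Definition rank (M : zmodType) : nat := xget 0%N [set r | has_rank M r]%classic.

(* A graded module is given by its homogeneous components. *)
Definition qdim (M : int -> zmodType) : qseries := fun k => (rank (M k))%:Z.

Section Complex.
Variables (G : graph) (n : int).
Implicit Types (s : {set 'I_(ne G)}) (j : 'I_(ne G)) (i : nat) (k : int).

(* The vertices of [G] index the variables; the exponent sequences [eps] of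
   the cube are identified with the corresponding edge sets [s]. *)
Local Notation poly := {mpoly int[nv G]}.

(* [m] is a monomial in the variables x_y, with y smallest in its component. *)
Definition supported_mon s (m : 'X_{1..nv G}) : bool :=
  [forall y, (m y != 0%N) ==> (cmin s y == y)].

(* Each variable has degree -1, and the module is shifted by
   {(ncomp s) * (n - 1) + #|s|}. *)
Definition mon_degree s (m : 'X_{1..nv G}) : int :=
  - (mdeg m)%:Z + ((ncomp s)%:Z * (n - 1) + #|s|%:Z).

(* The component of degree [k] of M_s. *)
Definition vertex_module s k : {pred poly} :=
  fun p => all (fun m => supported_mon s m && (mon_degree s m == k)) (msupp p).

(* The component of degree [k] of C^i, the direct sum of the M_s, #|s| = i. *)
Definition chain i k : {pred {ffun {set 'I_(ne G)} -> poly}} :=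
  fun c => [forall s : {set 'I_(ne G)}, if #|s| == i then c s \in vertex_module s k
                      else c s == 0].

(* The map M_s -> M_(j |: s), for [j] not in [s].  As n <= 2, [`|2 - n|] is
   the natural number 2 - n. *)
Definition edge_map s j (p : poly) : poly :=
  let x := cmin s (ends j).1 in
  let y := cmin s (ends j).2 in
  if x == y then 'X_x * p
  else let a := if (x < y)%N then x else y in
       let b := if (x < y)%N then y else x in
       'X_a ^+ `|2 - n|%N *
         (p \mPo [tuple if z == b then 'X_a else 'X_z | z < nv G]).

(* The component of [differential c] at [s] collects the edges of the cube
   s :\ j -> s; the sign counts the edges of s preceding j. *)
Definition differential (c : {ffun {set 'I_(ne G)} -> poly}) :
    {ffun {set 'I_(ne G)} -> poly} :=
  [ffun s : {set 'I_(ne G)} => \sum_(j in s)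
     (-1) ^+ #|[set e in s | (e < j)%N]| *: edge_map (s :\ j) j (c (s :\ j))].

Lemma edge_map_zmod_morphism s j : zmod_morphism (edge_map s j).
Proof.
move=> p q; rewrite /edge_map /=; case: ifP => _; first by rewrite mulrBr.
by rewrite raddfB mulrBr.
Qed.

Lemma differential_zmod_morphism : zmod_morphism differential.
Proof.
move=> c c'; apply/ffunP => s; rewrite !ffunE -sumrB; apply: eq_bigr => j _.
by rewrite !ffunE edge_map_zmod_morphism scalerBr.
Qed.

HB.instance Definition _ :=
  GRing.isZmodMorphism.Build _ _ differential differential_zmod_morphism.

Lemma vertex_module_zmod_closed s k : zmod_closed (vertex_module s k).
Proof.
split=> [|p q /allP hp /allP hq]; first by rewrite unfold_in msupp0.
apply/allP => m /msuppB_le; rewrite mem_cat => /orP[/hp|/hq] //.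
Qed.

HB.instance Definition _ s k :=
  GRing.isZmodClosed.Build _ (vertex_module s k)
    (vertex_module_zmod_closed s k).

Lemma chain_zmod_closed i k : zmod_closed (chain i k).
Proof.
split=> [|c c' /forallP hc /forallP hc']; apply/forallP => s.
  by rewrite ffunE rpred0 eqxx; case: ifP.
move: (hc s) (hc' s); rewrite !ffunE; case: ifP => _; first exact: rpredB.
by move=> /eqP -> /eqP ->; rewrite subrr.
Qed.

HB.instance Definition _ i k :=
  GRing.isZmodClosed.Build _ (chain i k) (chain_zmod_closed i k).

Definition cycles i k : {pred {ffun {set 'I_(ne G)} -> poly}} :=
  fun c => (c \in chain i k) && (differential c == 0).

Lemma cycles_zmod_closed i k : zmod_closed (cycles i k).
Proof.
split=> [|c c' /andP[hc /eqP dc] /andP[hc' /eqP dc']]; apply/andP.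
  by rewrite rpred0 raddf0.
by rewrite rpredB // raddfB /= dc dc' subrr.
Qed.

HB.instance Definition _ i k :=
  GRing.isZmodClosed.Build _ (cycles i k) (cycles_zmod_closed i k).

Record cycle i k := Cycle {
  cycle_val :> {ffun {set 'I_(ne G)} -> poly};
  cycleP : cycle_val \in cycles i k }.

HB.instance Definition _ i k := [isSub for @cycle_val i k].
HB.instance Definition _ i k := [Choice of cycle i k by <:].
HB.instance Definition _ i k :=
  [SubChoice_isSubZmodule of cycle i k by <:].

(* The image of the incoming differential, which consists of cycles since the
   differential squares to 0; the complex is 0 in position -1. *)
Definition boundaries i k : {pred cycle i k} :=
  fun z => if i is i'.+1
           then `[< exists2 b, b \in chain i' k & differential b = z >]
           else z == 0.

Lemma boundaries_zmod_closed i k : zmod_closed (@boundaries i k).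
Proof.
case: i => [|i].
  split=> [|z z' /eqP -> /eqP ->]; first exact: eqxx.
  by rewrite subrr; apply: eqxx.
split=> [|z z' /asboolP[b hb dz] /asboolP[b' hb' dz']]; apply/asboolP.
  by exists 0; rewrite ?rpred0 // !raddf0.
by exists (b - b'); rewrite ?rpredB // raddfB /= dz dz'.
Qed.

HB.instance Definition _ i k :=
  GRing.isZmodClosed.Build _ (@boundaries i k) (@boundaries_zmod_closed i k).

(* The component of degree [k] of the homology in position [i]. *)
Definition homology i k : zmodType := Quotient.quot (@boundaries i k).

Definition euler_char : qseries :=
  fun k => \sum_(i < (ne G).+1) (-1) ^+ i * qdim (homology i) k.

End Complex.

(* Main.v *)
Require Import Defs.
From HB Require Import structures.
From mathcomp Require Import all_boot all_order all_algebra.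
From mathcomp Require Import boolp classical_sets fsbigop.
From mathcomp Require Import mpoly.
From mathcomp Require Import ring zify.

(** The theorem is the Euler-Poincare principle applied in each degree [k],
    followed by a count of monomials.

    Fix [k].  The degree [k] part of the chain groups is free of finite rank:
    the degree of a monomial of M_s is minus its total degree up to a constant,
    so only finitely many monomials contribute.  Over the rationals it becomes
    a space of coordinate vectors, in which the cycles and the boundaries span
    subspaces, and the rank of the homology is the difference of the two
    dimensions ([quotient_has_rank], [homology_has_rank]).  Since the
    differential squares to 0 ([differential2]) and preserves the degree
    ([differential_chain]), rank-nullity and a telescoping sum replace the
    ranks of the homology groups by the ranks of the chain groups
    ([euler_char_basis]).

    Both properties of the differential come from one formula.  Adding an edge
    renames the representatives of the components ([cmin_merge]), and every
    edge map renames the variables accordingly and multiplies by a power of the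
    variable of the component that contains the new edge; the exponent is 2 - n
    or 1 according to whether the number of components drops
    ([edge_mapE]).  Two edges added in either order give the same renaming, and
    the same total exponent because the total drop is the same
    ([edge_map_comp]).

    It remains to compare, for each edge set s with c components, the number of
    monomials of degree [k] in M_s with the coefficient of q^k in
    q^|s| (q^n/(q-1))^c.  Both are coefficients of the c-th power of a truncated
    geometric series: a monomial chooses one exponent for each of the c
    variables ([card_exponents]), and q^n/(q-1) is q^(n-1) times the geometric
    series in 1/q ([qexp_w]). *)

Set Implicit Arguments.
Unset Strict Implicit.
Unset Printing Implicit Defensive.

Import Order.TTheory GRing.Theory Num.Theory.
Local Open Scope ring_scope.

(** * Ranks of abelian groups *)

Lemma zmod_morphismMn (A B : zmodType) (f : A -> B) :
  zmod_morphism f -> forall x N, f (x *+ N) = f x *+ N.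
Proof.
move=> fB x N; pose aM := GRing.isZmodMorphism.Build A B f fB.
pose g : {additive A -> B} := HB.pack f aM.
by rewrite -[f]/(g : A -> B) raddfMn.
Qed.

Lemma zmod_morphismN (A B : zmodType) (f : A -> B) :
  zmod_morphism f -> forall x, f (- x) = - f x.
Proof.
move=> fB x; have f0 : f 0 = 0 by rewrite -(subrr 0) fB subrr.
by rewrite -sub0r fB f0 sub0r.
Qed.

Lemma biadditive_balanced (M N W : zmodType) (f : M -> N -> W) :
  biadditive f -> forall x a K, f (x *+ K) a = f x (a *+ K).
Proof.
case=> fl fr x a K.
by rewrite (zmod_morphismMn (fr x)) -(zmod_morphismMn (fl a)).
Qed.

(** To know the rank of [M] it is enough to map [M] to a rational space [V] with
    torsion kernel and an image that meets every line: [V] is then a model of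
    the tensor product of [M] and the rationals. *)
Section RankCriterion.
Variables (M : zmodType) (V : vectType rat) (h : M -> V).
Hypothesis h_add : zmod_morphism h.
Hypothesis h_ker : forall x, h x = 0 -> exists2 N, (0 < N)%N & x *+ N = 0.
Hypothesis h_span : forall v, exists N x, (0 < N)%N /\ h x = v *+ N.

(** The value that a biadditive map must take at the fraction h x / N depends
    on the fraction only: a relation between fractions lifts to [M] up to
    torsion, and torsion is killed by divisibility of the rationals. *)
Lemma fraction_eq (W : zmodType) (f : M -> rat -> W) x y N L :
  biadditive f -> (0 < N)%N -> (0 < L)%N -> h x *+ L = h y *+ N ->
  f x N%:R^-1 = f y L%:R^-1.
Proof.
move=> fb N0 L0 e; have fM := biadditive_balanced fb.
have [|K K0] := h_ker (x := x *+ L - y *+ N).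
  by rewrite h_add !(zmod_morphismMn h_add) e subrr.
rewrite mulrnBl => /eqP; rewrite subr_eq0 -!mulrnA => /eqP eK.
have inv_split A B : (0 < B)%N -> A%:R^-1 = (A * B)%:R^-1 *+ B :> rat.
  by move=> B0; rewrite -[RHS]mulr_natr natrM invfM mulfVK // pnatr_eq0 -lt0n.
(* Both values are rewritten over the common denominator N * L * K. *)
rewrite (inv_split N (L * K)%N) ?muln_gt0 ?L0 // -fM eK fM.
by rewrite (inv_split L (N * K)%N) ?muln_gt0 ?N0 // mulnCA.
Qed.

Lemma has_rank_criterion : has_rank M (\dim {:V}).
Proof.
exists V, (fun x a => a *: h x); split=> //; split.
- split=> [a x y|x a b]; first by rewrite h_add scalerBr.
  by rewrite scalerBl.
- by move=> x a b; rewrite scalerA.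
move=> W f fb; have fM := biadditive_balanced fb; have [fl fr] := fb.
(* Each v is written once and for all as a fraction h (X v) / N v. *)
pose N v := projT1 (cid (h_span v)).
have NP v : exists x, (0 < N v)%N /\ h x = v *+ N v := projT2 (cid (h_span v)).
pose X v := projT1 (cid (NP v)).
have XP v : (0 < N v)%N /\ h (X v) = v *+ N v := projT2 (cid (NP v)).
pose g v := f (X v) (N v)%:R^-1.
have gE v x L : (0 < L)%N -> h x = v *+ L -> g v = f x L%:R^-1.
  have [N0 eN] := XP v; move=> L0 eL; apply: fraction_eq => //.
  by rewrite eN eL -!mulrnA mulnC.
have unfrac x L (a : rat) : (0 < L)%N -> f (x *+ L) (a / L%:R) = f x a.
  move=> L0; rewrite fM -[X in f x X]mulr_natr mulfVK //.
  by rewrite pnatr_eq0 -lt0n.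
have g_add : zmod_morphism g.
  move=> u v; have [Nu eu] := XP u; have [Nv ev] := XP v.
  rewrite (gE _ (X u *+ N v - X v *+ N u) (N u * N v)%N) ?muln_gt0 ?Nu //;
    last first.
    rewrite h_add !(zmod_morphismMn h_add) eu ev -!mulrnA mulrnBl.
    by rewrite [in RHS]mulnC // [(N v * N u)%N]mulnC.
  rewrite fl natrM invfM; congr (_ - _); first exact: unfrac.
  by rewrite mulrC unfrac.
have g_tens x a : g (a *: h x) = f x a.
  have d0 : (0 < `|denq a|)%N by rewrite absz_gt0 denq_neq0.
  have aE : a * `|denq a|%:R = (numq a)%:~R.
    rewrite -[X in X * _]divq_num_den natr_absz ger0_norm ?denq_ge0 //.
    by rewrite mulfVK // intr_eq0 denq_neq0.
  rewrite (gE _ (x *~ numq a) `|denq a|%N) //; last first.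
    rewrite -scaler_nat scalerA mulrC aE scaler_int.
    case: (numq a) => k; first by rewrite -!pmulrn (zmod_morphismMn h_add).
    rewrite !NegzE !mulrNz -!pmulrn.
    by rewrite (zmod_morphismN h_add) (zmod_morphismMn h_add).
  have a_frac : a = (numq a)%:~R * `|denq a|%:R^-1.
    by rewrite -aE mulfK // pnatr_eq0 -lt0n.
  rewrite [in RHS]a_frac.
  set D := _%:R^-1; have fN y b : f (- y) b = f y (- b).
    by rewrite (zmod_morphismN (fr y)) -(zmod_morphismN (fl b)).
  case: (numq a) => k.
    by rewrite -[LHS]/(f (x *+ k) D) -[RHS]/(f x (k%:R * D)) fM mulr_natl.
  rewrite -[LHS]/(f (- (x *+ k.+1)) D) -[RHS]/(f x (- k.+1%:R * D)).
  by rewrite fN fM mulNr mulr_natl mulNrn.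
exists g; split=> // g' [g'_add g'_tens]; apply: funext => v.
have [N0 eN] := XP v.
rewrite /g -g'_tens eN -scaler_nat scalerA mulVf ?scale1r //.
by rewrite pnatr_eq0 -lt0n.
Qed.

End RankCriterion.

(** The comparison map between two tensor products is additive, hence linear
    over the rationals, and the universal property makes it injective. *)
Lemma has_rank_le (M : zmodType) r r' :
  has_rank M r -> has_rank M r' -> (r <= r')%N.
Proof.
move=> [T [t [tP <-]]] [T' [t' [tP' <-]]].
have [g [[g_add gt] _]] := tensor_universal tP (tensor_biadditive tP').
have [g' [[g'_add g't] _]] := tensor_universal tP' (tensor_biadditive tP).
have gK x : g' (g x) = x.
  have [u [_ uP]] := tensor_universal tP (tensor_biadditive tP).
  have u_id : u = id by apply: uP.
  have u_gg : u = g' \o g.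
    apply: uP; split=> [y z|y a] /=; first by rewrite g_add g'_add.
    by rewrite gt g't.
  by rewrite -[LHS]/((g' \o g) x) -u_gg u_id.
pose aM := GRing.isZmodMorphism.Build T T' g g_add.
pose sM := GRing.isScalable.Build _ _ _ _ g (rat_linear g_add).
pose gL : {linear T -> T'} := HB.pack g aM sM.
have ker0 : (fullv :&: lker (linfun gL) = 0)%VS.
  apply/eqP; rewrite -subv0; apply/subvP => x /memv_capP[_].
  rewrite memv_ker lfunE /= memv0 => /eqP gx; rewrite -(gK x) gx.
  by rewrite -(subrr 0) g'_add subrr.
by rewrite -(limg_dim_eq ker0) dimvS ?subvf.
Qed.

Lemma rankE (M : zmodType) r : has_rank M r -> rank M = r.
Proof.
move=> Mr; rewrite /rank; case: xgetP => [r' _ Mr'|/(_ r)]; last by case.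
by apply/eqP; rewrite eqn_leq (has_rank_le Mr) // (has_rank_le Mr').
Qed.

(** Up to clearing denominators, [U] is the rational vector space spanned by
    [phi S]; for an additive [S] no linear combinations are needed. *)
Definition rational_span (A : zmodType) (V : vectType rat) (phi : A -> V)
    (S : {pred A}) (U : {vspace V}) : Prop :=
  (forall x, x \in S -> phi x \in U) /\
  (forall u, u \in U -> exists N x, [/\ (0 < N)%N, x \in S & phi x = u *+ N]).

Section QuotientRank.
Local Open Scope quotient_scope.
Variables (A : zmodType) (B : zmodClosed A) (V : vectType rat).
Variables (phi : {additive A -> V}) (UA UB : {vspace V}).
Hypothesis phi_inj : injective phi.
Hypothesis spanA : rational_span phi predT UA.
Hypothesis spanB : rational_span phi (mem B) UB.

Lemma rational_span_sub : (UB <= UA)%VS.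
Proof.
apply/subvP => u /(proj2 spanB)[N [x [N0 _ ex]]].
have /(memvZ (N%:R^-1 : rat)) := proj1 spanA x isT.
by rewrite ex -scaler_nat scalerA mulVf ?scale1r // pnatr_eq0 -lt0n.
Qed.

(** The quotient is sent to a complement of [UB] by the projection along [UB];
    an element with coordinates in [UB] has a multiple in [B], so the kernel is
    torsion. *)
Lemma quotient_has_rank :
  has_rank (Quotient.quot B) (\dim UA - \dim UB).
Proof.
pose P : 'End(V) := (\1 - projv UB)%VF.
have PE v : P v = v - projv UB v by rewrite !lfunE /= opp_lfunE id_lfunE.
have P0 v : (P v == 0) = (v \in UB).
  rewrite PE subr_eq0; apply/eqP/idP => [->|vU]; first exact: memv_proj.
  by rewrite projv_id.
have kerP : (UA :&: lker P = UB)%VS.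
  apply/vspaceP => v; rewrite memv_cap memv_ker P0 andb_idl //.
  by move/(subvP rational_span_sub).
have dimP : (\dim UA - \dim UB)%N = \dim (P @: UA)%VS.
  by rewrite -[in LHS](limg_ker_dim P UA) kerP addKn.
pose W := (P @: UA)%VS.
have hW (x : Quotient.quot B) : P (phi (repr x)) \in W.
  by rewrite memv_img // (proj1 spanA).
pose h x : subvs_of W := Subvs (hW x).
pose pr (x : A) : Quotient.quot B := \pi_(Quotient.quot B) x.
have prK x : pr (repr x) = x by exact: reprK.
have prB x y : pr (x - y) = pr x - pr y by exact: raddfB.
have pr0 x : pr x = 0 <-> x \in B.
  rewrite -(subr0 x) Quotient.idealrBE subr0 -(subrr (pr 0)) -prB subr0.
  by split=> [h0|/eqP]; [apply/eqP|].
have hE x : vsval (h (pr x)) = P (phi x).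
  apply/eqP; rewrite -subr_eq0 /= -linearB P0 -raddfB (proj1 spanB) //=.
  by apply/pr0; rewrite prB prK subrr.
have h_add : zmod_morphism h.
  move=> x y; rewrite -(prK x) -(prK y) -prB; apply/val_inj.
  have valB (a b : subvs_of W) : vsval (a - b) = vsval a - vsval b.
    exact: raddfB.
  by rewrite -[LHS]/(vsval _) [RHS]valB !hE raddfB linearB.
rewrite dimP -/W.
have -> : \dim W = \dim {:subvs_of W} by rewrite dimvf.
apply: (has_rank_criterion (h := h)) => //.
  move=> x /(congr1 vsval); rewrite -(prK x) hE => /eqP.
  rewrite P0 => /(proj2 spanB)[N [b [N0 bB eb]]]; exists N => //.
  have rb : repr x *+ N = b by apply: phi_inj; rewrite raddfMn eb.
  by rewrite -(zmod_morphismMn prB) rb; apply/pr0.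
move=> v; have /memv_imgP[u uA eu] := valP v.
have [N [x [N0 _ ex]]] := proj2 spanA u uA.
exists N, (pr x); split=> //; apply/val_inj.
rewrite -[LHS]/(vsval _) -[RHS]/(vsval _) hE ex.
by rewrite linearMn [RHS]linearMn; congr (_ *+ N); apply/esym.
Qed.

End QuotientRank.

(** * Components after the addition of an edge *)

Section Components.
Variable G : graph.
Implicit Types (s : {set 'I_(ne G)}) (x y z : 'I_(nv G)) (j : 'I_(ne G)).

Lemma adj_sym s : ssrbool.symmetric (adj s).
Proof. by move=> x y; apply: eq_existsb => e; rewrite orbC. Qed.

Lemma connect_adj_sym s : connect_sym (adj s).
Proof. exact/sym_connect_sym/adj_sym. Qed.

Lemma adj_ends s j : j \in s -> adj s (ends j).1 (ends j).2.
Proof.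
by move=> js; apply/existsP; exists j; rewrite js -surjective_pairing eqxx.
Qed.

Lemma cmin_connect s x : connect (adj s) x (cmin s x).
Proof. by rewrite /cmin; case: arg_minnP. Qed.

Lemma cmin_min s x y : connect (adj s) x y -> (cmin s x <= y)%N.
Proof. by rewrite /cmin; case: arg_minnP => // z _ h /h. Qed.

Lemma cmin_le s x : (cmin s x <= x)%N.
Proof. exact: cmin_min. Qed.

Lemma eq_cmin s x y : (cmin s x == cmin s y) = connect (adj s) x y.
Proof.
apply/eqP/idP => [e|cxy].
  apply: connect_trans (cmin_connect s x) _.
  by rewrite e connect_adj_sym cmin_connect.
have le_cmin u v : connect (adj s) u v -> (cmin s u <= cmin s v)%N.
  by move=> cuv; apply: cmin_min (connect_trans cuv (cmin_connect s v)).
by apply/val_inj/eqP; rewrite eqn_leq !le_cmin // connect_adj_sym.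
Qed.

Lemma cmin_idem s x : cmin s (cmin s x) = cmin s x.
Proof. by apply/eqP; rewrite eq_cmin connect_adj_sym cmin_connect. Qed.

(** This characterizes [cmin] by local conditions, so that a candidate for the
    representatives of a larger graph can be checked edge by edge. *)
Lemma cmin_unique s (g : 'I_(nv G) -> 'I_(nv G)) :
  (forall x, connect (adj s) x (g x)) -> (forall x, (g x <= x)%N) ->
  (forall e, e \in s -> g (ends e).1 = g (ends e).2) -> cmin s =1 g.
Proof.
move=> gc gle gadj x.
have g_const : forall y, connect (adj s) x y -> g x = g y.
  move=> y /connectP[p]; elim: p x => [x _ -> //|z p IHp x /= /andP[xz pz] yE].
  rewrite -(IHp z pz yE); case/existsP: xz => e /andP[es].
  by case/orP => /eqP ee; have := gadj e es; rewrite ee.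
apply/val_inj/eqP; rewrite eqn_leq cmin_min //=.
by rewrite (g_const _ (cmin_connect s x)) gle.
Qed.

(** [cmin] and [root] choose representatives of the same classes, so that each
    maps the fixed points of the other bijectively to its own. *)
Lemma ncompE s : ncomp s = #|[set y | cmin s y == y]|.
Proof.
have rootE x y :
    (fingraph.root (adj s) x == fingraph.root (adj s) y) = connect (adj s) x y.
  exact: root_connect (connect_adj_sym s) x y.
rewrite /ncomp /n_comp_mem -[LHS](card_in_imset (f := cmin s)) => [|x y].
  apply: eq_card => y; rewrite [RHS]inE; apply/imsetP/eqP => [[x _ ->]|e].
    exact: cmin_idem.
  exists (fingraph.root (adj s) y).
    by rewrite !inE roots_root //; apply: connect_adj_sym.
  apply/eqP; rewrite -{1}e eq_cmin; apply: connect_root.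
rewrite !inE !andbT => /eqP rx /eqP ry /eqP; rewrite eq_cmin -rootE => /eqP.
by rewrite rx ry.
Qed.

(** The representatives of the components of the two ends of [j], in order; the
    second one stops being a representative when [j] is added.  They coincide
    when [j] lies in one component, and then [merge] is the identity. *)
Definition survivor s j :=
  let x := cmin s (ends j).1 in let y := cmin s (ends j).2 in
  if (x < y)%N then x else y.

Definition absorbed s j :=
  let x := cmin s (ends j).1 in let y := cmin s (ends j).2 in
  if (x < y)%N then y else x.

Definition merge s j z := if z == absorbed s j then survivor s j else z.

Lemma survivor_le_absorbed s j : (survivor s j <= absorbed s j)%N.
Proof. by rewrite /survivor /absorbed; case: ltnP => [/ltnW|]. Qed.

Lemma survivor_eq_absorbed s j :
  (survivor s j == absorbed s j) = (cmin s (ends j).1 == cmin s (ends j).2).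
Proof. by rewrite /survivor /absorbed; case: ifP => //; rewrite eq_sym. Qed.

Lemma cmin_survivor s j : cmin s (survivor s j) = survivor s j.
Proof. by rewrite /survivor; case: ifP; rewrite cmin_idem. Qed.

Lemma cmin_absorbed s j : cmin s (absorbed s j) = absorbed s j.
Proof. by rewrite /absorbed; case: ifP; rewrite cmin_idem. Qed.

Lemma connectS s (t : {set _}) x y :
  s \subset t -> connect (adj s) x y -> connect (adj t) x y.
Proof.
move=> /fintype.subsetP st; apply: connect_sub => u v /existsP[e /andP[es ee]].
by apply/connect1/existsP; exists e; rewrite st.
Qed.

(** The candidate on the right takes equal values at the ends of the old edges,
    since [cmin s] does, and at the ends of [j], whose two representatives
    [merge] identifies; it moves every vertex down because the smaller
    representative is kept. *)
Lemma cmin_merge s j : cmin (j |: s) =1 merge s j \o cmin s.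
Proof.
have sub : s \subset j |: s.
  by apply/fintype.subsetP => e; rewrite !inE orbC => ->.
have conn_ends : connect (adj (j |: s)) (absorbed s j) (survivor s j).
  have c1 i : connect (adj (j |: s)) (cmin s i) i.
    by apply: (connectS sub); rewrite connect_adj_sym cmin_connect.
  have c12 : connect (adj (j |: s)) (cmin s (ends j).1) (cmin s (ends j).2).
    apply: connect_trans (c1 _) _; rewrite connect_adj_sym.
    apply: connect_trans (c1 _) _; rewrite connect_adj_sym.
    by apply/connect1/adj_ends/finset.setU11.
  by rewrite /absorbed /survivor; case: ifP; rewrite // connect_adj_sym.
apply: cmin_unique => [x|x|e] /=.
- apply: connect_trans (connectS sub (cmin_connect s x)) _.
  by rewrite /merge; case: eqP => [->|].
- rewrite /merge; case: eqP => [e|_]; last exact: cmin_le.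
  by rewrite (leq_trans (survivor_le_absorbed s j)) // -e cmin_le.
rewrite !inE => /orP[/eqP->|es]; last first.
  by congr merge; apply/eqP; rewrite eq_cmin connect1 ?adj_ends.
rewrite /merge /survivor /absorbed; case: (ltnP (cmin s (ends j).1)) => h.
  by rewrite eqxx; case: eqP.
by rewrite eqxx; case: eqP => // ->.
Qed.

Lemma cmin_fix_merge s j z :
  (cmin (j |: s) z == z) =
  (cmin s z == z) && ((z == absorbed s j) ==> (z == survivor s j)).
Proof.
rewrite cmin_merge /= /merge; case: (cmin s z =P absorbed s j) => [e|ne].
  case: (z =P absorbed s j) => [->|ne] /=.
    by rewrite cmin_absorbed eqxx eq_sym.
  rewrite e andbT [RHS]eq_sym; move/eqP/negPf: (ne) => ->; apply/eqP => ez.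
  by apply: ne; rewrite -e -ez cmin_survivor.
case: (z =P absorbed s j) => [ez|_]; last by rewrite andbT.
by case: ne; rewrite ez cmin_absorbed.
Qed.

(** By [cmin_fix_merge], the only representative that can be lost is
    [absorbed s j]. *)
Lemma ncomp_merge s j :
  ncomp s = (ncomp (j |: s) + (cmin s (ends j).1 != cmin s (ends j).2))%N.
Proof.
rewrite !ncompE -survivor_eq_absorbed.
rewrite (cardsD1 (absorbed s j)) inE cmin_absorbed eqxx.
rewrite [X in _ = (X + _)%N](cardsD1 (absorbed s j)) inE cmin_fix_merge.
rewrite cmin_absorbed !eqxx /=.
rewrite [absorbed s j == _]eq_sym addnAC; congr (_ + _)%N; first by case: eqP.
apply: eq_card => z; rewrite !inE cmin_fix_merge.
by case: (z == absorbed s j); rewrite // andbT.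
Qed.

Lemma merge_cmin s j x : merge s j (cmin s x) = cmin (j |: s) x.
Proof. by rewrite cmin_merge. Qed.

Lemma merge_non_min s j z : cmin s z != z -> merge s j z = z.
Proof.
move=> ne; rewrite /merge ifN //; apply: contraNneq ne => ->.
by rewrite cmin_absorbed.
Qed.

(** The right-hand side is symmetric in [j1] and [j2]. The vertices that are no
    representatives for [s] stay in place, which makes the formula valid for
    all labels and not only for the variables of M_s. *)
Lemma merge2E s j1 j2 z :
  merge (j1 |: s) j2 (merge s j1 z) =
  if cmin s z == z then cmin (j2 |: (j1 |: s)) z else z.
Proof.
case: ifP => [/eqP e|/negbT ne]; first by rewrite -[in LHS]e !merge_cmin.
rewrite [merge s j1 z]merge_non_min // merge_non_min //.
by rewrite cmin_fix_merge negb_and ne.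
Qed.

Lemma survivorE s j : survivor s j = cmin (j |: s) (ends j).1.
Proof.
rewrite cmin_merge /= /merge /survivor /absorbed.
case: ltnP => h; last by rewrite eqxx.
by case: eqP => // e; rewrite e ltnn in h.
Qed.

End Components.

(** * The differential *)

Section Relabel.
Variable N : nat.
Implicit Types (f g : 'I_N -> 'I_N) (m : 'X_{1..N}) (p : {mpoly int[N]}).

Definition relabel f p := p \mPo [tuple 'X_(f z) | z < N].

Definition mrelabel f m : 'X_{1..N} :=
  (\big[+%MM/0%MM]_(z < N) (U_(f z) *+ m z))%MM.

Lemma relabelX f m : relabel f 'X_[m] = 'X_[mrelabel f m].
Proof.
rewrite /relabel comp_mpolyX (big_morph _ (@mpolyXD _ _) (@mpolyX0 _ _)).
apply: eq_bigr => z _.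
by rewrite tnth_mktuple mpolyXn.
Qed.

Fact relabel_is_linear f : linear (relabel f).
Proof. by move=> a p q; rewrite /relabel linearP. Qed.

Fact relabel_is_monoid_morphism f : monoid_morphism (relabel f).
Proof.
by rewrite /relabel; split=> [|p q]; [apply: rmorph1|apply: rmorphM].
Qed.

HB.instance Definition _ f :=
  GRing.isLinear.Build int {mpoly int[N]} {mpoly int[N]} *:%R (relabel f)
    (relabel_is_linear f).
HB.instance Definition _ f :=
  GRing.isMonoidMorphism.Build {mpoly int[N]} {mpoly int[N]} (relabel f)
    (relabel_is_monoid_morphism f).

Lemma relabelXU f z : relabel f 'X_z = 'X_(f z).
Proof. by rewrite /relabel comp_mpolyXU -tnth_nth tnth_mktuple. Qed.

Lemma relabel_mon f m : relabel f 'X_[m] = \prod_(z < N) 'X_(f z) ^+ m z.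
Proof.
by rewrite /relabel comp_mpolyX; apply: eq_bigr => z _; rewrite tnth_mktuple.
Qed.

Lemma relabel_comp f g p : relabel g (relabel f p) = relabel (g \o f) p.
Proof.
have relabelE h q : relabel h q = \sum_(m <- msupp q) q@_m *: relabel h 'X_[m].
  exact: comp_mpolyEX.
rewrite (relabelE f) (relabelE (g \o f)) [LHS]linear_sum; apply: eq_bigr => m _.
rewrite linearZ !relabel_mon rmorph_prod; congr (_ *: _).
by apply: eq_bigr => z _; rewrite rmorphXn /= relabelXU.
Qed.

Lemma eq_relabel f g p : f =1 g -> relabel f p = relabel g p.
Proof.
by move=> fg; congr (_ \mPo _); apply: eq_mktuple => z; rewrite fg.
Qed.

Lemma relabel_id p : relabel id p = p.
Proof. exact: comp_mpoly_id. Qed.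

Lemma mdeg_mrelabel f m : mdeg (mrelabel f m) = mdeg m.
Proof.
rewrite /mrelabel mdeg_sum [RHS]mdegE; apply: eq_bigr => z _.
by rewrite mdegMn mdeg1 mul1n.
Qed.

Lemma mrelabel_supp f m y :
  mrelabel f m y != 0%N -> exists2 z, m z != 0%N & f z = y.
Proof.
rewrite /mrelabel mnm_sumE sum_nat_eq0 => /forallPn[z].
rewrite mulmnE mnm1E; case: (f z =P y) => // e; rewrite mul1n => mz.
by exists z.
Qed.

End Relabel.

Section Differential.
Variables (G : graph) (n : int).
Implicit Types (s : {set 'I_(ne G)}) (j : 'I_(ne G)) (x y z : 'I_(nv G)).

Definition joins s j := cmin s (ends j).1 != cmin s (ends j).2.

Definition weight s j : nat := if joins s j then `|2 - n|%N else 1%N.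

(** The two cases of the definition agree with one formula, because [merge] is
    the identity when [j] joins nothing. *)
Lemma edge_mapE s j p :
  edge_map n s j p = 'X_(survivor s j) ^+ weight s j * relabel (merge s j) p.
Proof.
rewrite /edge_map /weight /joins; case: eqP => [e|_] /=; last first.
  rewrite -/(survivor s j) -/(absorbed s j) /relabel; congr (_ * (p \mPo _)).
  by apply: eq_mktuple => z; rewrite /merge; case: eqP.
rewrite expr1 (@eq_relabel _ _ id) ?relabel_id ?/survivor -?e ?ltnn // => z.
by rewrite /merge /absorbed /survivor -e ltnn; case: eqP.
Qed.

Lemma edge_map_linear s j : linear (edge_map n s j).
Proof.
by move=> a p q; rewrite !edge_mapE /relabel linearP mulrDr scalerAr.
Qed.
HB.instance Definition _ s j :=
  GRing.isLinear.Build _ _ _ _ (edge_map n s j) (edge_map_linear s j).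

(** If adding [j2] connects ends of [j1] that lay in distinct components, then
    [j2] links these two components, so that all four ends get into one. *)
Lemma joins_eq_or_connected s j1 j2 :
  joins s j1 = joins (j2 |: s) j1 \/
  cmin (j2 |: s) (ends j1).1 = cmin (j2 |: s) (ends j2).1.
Proof.
rewrite -survivorE /joins !cmin_merge /= /merge.
case: (cmin s (ends j1).1 =P absorbed s j2) => [_|/eqP ne]; first by right.
case: (cmin s (ends j1).2 =P absorbed s j2) => [->|_]; last by left.
by rewrite (negbTE ne); case: eqP; [right|left].
Qed.

(** Both sides are the drop in the number of components. *)
Lemma joins_add s j1 j2 :
  (joins s j1 + joins (j1 |: s) j2 = joins s j2 + joins (j2 |: s) j1)%N.
Proof.
apply: (@addnI (ncomp (j1 |: (j2 |: s)))).
have := ncomp_merge s j1; have := ncomp_merge (j1 |: s) j2.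
have := ncomp_merge s j2; have := ncomp_merge (j2 |: s) j1.
rewrite /joins [j2 |: (j1 |: s)]finset.setUCA; lia.
Qed.

Lemma edge_map2E s j1 j2 p :
  let t := j2 |: (j1 |: s) in
  edge_map n (j1 |: s) j2 (edge_map n s j1 p) =
  'X_(cmin t (ends j2).1) ^+ weight (j1 |: s) j2 *
  'X_(cmin t (ends j1).1) ^+ weight s j1 *
  relabel (fun z => if cmin s z == z then cmin t z else z) p.
Proof.
rewrite /= edge_mapE [X in relabel _ X]edge_mapE.
rewrite (rmorphM (relabel (merge (j1 |: s) j2))).
rewrite (rmorphXn (relabel (merge (j1 |: s) j2))) /= relabelXU relabel_comp.
rewrite mulrA !survivorE merge_cmin; congr (_ * _).
by apply: eq_relabel => z /=; rewrite merge2E.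
Qed.

(** Commutativity of the square faces of the cube: either the exponents do not
    depend on the order of the edges, or the two variables become equal and only
    the sum of the exponents matters. *)
Lemma edge_map_comp s j1 j2 p :
  edge_map n (j1 |: s) j2 (edge_map n s j1 p) =
  edge_map n (j2 |: s) j1 (edge_map n s j2 p).
Proof.
rewrite !edge_map2E [j1 |: (j2 |: s)]finset.setUCA; congr (_ * _).
have [E|C] := joins_eq_or_connected s j1 j2.
  have E2 : joins (j1 |: s) j2 = joins s j2.
    by have := joins_add s j1 j2; rewrite E; do 3!case: (joins _ _).
  by rewrite /weight E E2 mulrC.
set u := cmin _ (ends j2).1; set v := cmin _ (ends j1).1.
have -> : v = u.
  apply/eqP; rewrite eq_cmin; move/eqP: C; rewrite eq_cmin.
  by apply: connectS; rewrite finset.setUCA finset.subsetUr.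
rewrite -!exprD; congr (_ ^+ _); have := joins_add s j1 j2.
by rewrite /weight; move: `|2 - n|%N => N; do 4!case: (joins _ _); lia.
Qed.

Lemma count_before s i j : i \in s ->
  #|[set e in s | (e < j)%N]| = ((i < j) + #|[set e in s :\ i | (e < j)%N]|)%N.
Proof.
move=> is_; rewrite (cardsD1 i) inE is_; congr (_ + _)%N; apply: eq_card => e.
by rewrite !inE andbA.
Qed.

(** The square faces commute, and the signs of their two paths are opposite: the
    removal of one edge changes the sign attached to the other one exactly when
    it precedes it. *)
Lemma differential2 (c : {ffun {set 'I_(ne G)} -> {mpoly int[nv G]}}) :
  differential n (differential n c) = 0.
Proof.
apply/ffunP => s; rewrite !ffunE.
pose sg (t : {set 'I_(ne G)}) (j : 'I_(ne G)) : int :=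
  (-1) ^+ #|[set e in t | (e < j)%N]|.
pose T j i := (sg s j * sg (s :\ j) i) *:
  edge_map n (s :\ j) j (edge_map n (s :\ j :\ i) i (c (s :\ j :\ i))).
have TE : forall j i, j \in s -> i \in s -> i != j -> T j i = - T i j.
  move=> j i js is_ ij; rewrite /T.
  have e1 : s :\ j :\ i = s :\ i :\ j by rewrite !finset.setDDl finset.setUC.
  have e2 : s :\ j = i |: (s :\ i :\ j).
    by rewrite -e1 finset.setD1K // !inE ij is_.
  have e3 : s :\ i = j |: (s :\ i :\ j).
    by rewrite finset.setD1K // !inE eq_sym ij js.
  rewrite e1 [in edge_map n (s :\ j)]e2 [in edge_map n (s :\ i)]e3.
  rewrite edge_map_comp -scaleNr; congr (_ *: _).
  rewrite /sg (count_before j is_) (count_before i js) !exprD.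
  case: (ltngtP i j) => [||/val_inj h]; last by rewrite h eqxx in ij.
  - by move=> _; rewrite expr0 expr1; ring.
  - by move=> _; rewrite expr0 expr1; ring.
transitivity (\sum_(j in s) \sum_(i in s | i != j) T j i).
  apply: eq_bigr => j js; rewrite ffunE linear_sum scaler_sumr /=.
  apply: eq_big => [i|i _]; first by rewrite !inE andbC.
  by rewrite linearZ scalerA.
(* Each unordered pair of edges is visited once, with its larger edge first. *)
transitivity (\sum_(j in s) \sum_(i in s | (i < j)%N) (T j i + T i j));
  last first.
  rewrite big1 // => j js; rewrite big1 // => i /andP[is_ ij].
  by rewrite (TE j i) // ?addNr // neq_ltn ij.
under [RHS]eq_bigr do rewrite big_split /=.
rewrite big_split /=.
rewrite [X in _ = _ + X](exchange_big_dep (mem s)) /=; last first.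
  by move=> ? ? _ /andP[].
rewrite -big_split /=; apply: eq_bigr => j js.
rewrite (bigID (fun i : 'I_(ne G) => (i < j)%N)) /=; congr (_ + _).
  apply: eq_bigl => i; rewrite -andbA; congr (_ && _).
  by rewrite -(inj_eq val_inj) neq_ltn; case: ltngtP.
apply: eq_bigl => i; rewrite js /= -andbA; congr (_ && _).
by rewrite -(inj_eq val_inj) neq_ltn; case: ltngtP.
Qed.

Lemma mon_vertex_module s k (m : 'X_{1..nv G}) :
  ('X_[m] \in vertex_module n s k) =
  supported_mon s m && (mon_degree n s m == k).
Proof. by rewrite unfold_in /= msuppX /= andbT. Qed.

Hypothesis hn : n <= 2.

(** The shift makes up for the change of degree.  Inside one component, the
    factor of degree -1 cancels the shift by the new edge.  When two components
    merge, the factor of degree n - 2 and the new edge together give n - 1, the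
    shift that the lost component contributed. *)
Lemma edge_map_mon s j k (m : 'X_{1..nv G}) : j \notin s ->
  'X_[m] \in vertex_module n s k ->
  edge_map n s j 'X_[m] \in vertex_module n (j |: s) k.
Proof.
move=> js; rewrite mon_vertex_module => /andP[/forallP msupp /eqP mk].
rewrite edge_mapE relabelX mpolyXn -mpolyXD mon_vertex_module.
apply/andP; split.
  apply/forallP => y; apply/implyP; rewrite mnmDE addn_eq0 negb_and.
  case/orP => [|/mrelabel_supp[z mz <-]].
    rewrite mulmnE mnm1E; case: (survivor s j =P y) => // <- _.
    by rewrite survivorE cmin_idem.
  by have /implyP/(_ mz)/eqP <- := msupp z; rewrite merge_cmin cmin_idem.
rewrite -mk /mon_degree mdegD mdeg_mrelabel mdegMn mdeg1 mul1n cardsU1 js.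
rewrite (ncomp_merge s j) -/(joins s j) /weight; apply/eqP.
have : (`|2 - n|%N : int) = 2 - n by rewrite gez0_abs // subr_ge0.
by case: joins => /=; nia.
Qed.

Lemma edge_map_vertex_module s j k p : j \notin s ->
  p \in vertex_module n s k -> edge_map n s j p \in vertex_module n (j |: s) k.
Proof.
move=> js /allP hp; rewrite [p]mpolyE linear_sum big_seq rpred_sum // => m mp.
rewrite linearZ /= -[p@_m]intz scaler_int rpredMz // edge_map_mon //.
by rewrite mon_vertex_module hp.
Qed.

Lemma differential_chain i k (c : {ffun {set 'I_(ne G)} -> {mpoly int[nv G]}}) :
  c \in chain n i k -> differential n c \in chain n i.+1 k.
Proof.
move/forallP => hc; apply/forallP => s; rewrite ffunE.
have card_s j : j \in s -> (#|s :\ j| == i) = (#|s| == i.+1).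
  by move=> js; rewrite (cardsD1 j s) js.
case: ifP => si; last first.
  rewrite big1 // => j js; have := hc (s :\ j).
  by rewrite card_s // si => /eqP ->; rewrite linear0 scaler0.
apply: rpred_sum => j js; rewrite -signr_odd.
have cj : edge_map n (s :\ j) j (c (s :\ j)) \in vertex_module n s k.
  have := hc (s :\ j); rewrite card_s // si => cj.
  rewrite -[X in vertex_module n X](finset.setD1K js).
  by apply: edge_map_vertex_module cj; rewrite !inE eqxx.
by case: odd; rewrite ?expr1 ?expr0 ?scale1r // scaleN1r rpredN.
Qed.

End Differential.

(** * The Euler-Poincare principle *)

Section CoordSpace.
Variable I : finType.
Implicit Types (A : {set I}) (v : {ffun I -> rat^o}).

Definition mask_out A v : {ffun I -> rat^o} :=
  [ffun u => if u \in A then 0 else v u].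
Fact mask_out_linear A : linear (mask_out A).
Proof.
move=> a v w; apply/ffunP => u; rewrite !ffunE; case: ifP => // _.
by rewrite scaler0 addr0.
Qed.
HB.instance Definition _ A :=
  GRing.isLinear.Build _ _ _ _ (mask_out A) (mask_out_linear A).

Definition coord_space A : {vspace {ffun I -> rat^o}} :=
  lker (linfun (mask_out A)).

Lemma coord_spaceP A v :
  reflect (forall u, u \notin A -> v u = 0) (v \in coord_space A).
Proof.
rewrite memv_ker lfunE /=; apply: (iffP eqP) => [v0 u uA|v0].
  by have /ffunP/(_ u) := v0; rewrite !ffunE (negbTE uA).
by apply/ffunP => u; rewrite !ffunE; case: ifP => // /negbT/v0.
Qed.

Definition delta u : {ffun I -> rat^o} := [ffun w => (w == u)%:R].

Lemma delta_sum v : v = \sum_u v u *: delta u.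
Proof.
apply/ffunP => w; rewrite sum_ffunE (bigD1 w) //= !ffunE eqxx.
rewrite [_ *: _]mulr1 big1 ?addr0 // => u uw.
by rewrite !ffunE eq_sym (negbTE uw) scaler0.
Qed.

Lemma dim_coord_space A : \dim (coord_space A) = #|A|.
Proof.
have full : basis_of fullv [seq delta u | u <- enum I].
  rewrite basisEdim size_map -cardE dimvf; apply/andP; split; last first.
    by rewrite /dim /= muln1.
  apply/subvP => v _; rewrite [v]delta_sum memv_suml // => u _.
  by rewrite memvZ // memv_span // map_f // mem_enum.
have -> : coord_space A = <<[seq delta u | u <- enum A]>>%VS.
  apply/eqP; rewrite eqEsubv; apply/andP; split.
    apply/subvP => v /coord_spaceP v0; rewrite [v]delta_sum.
    apply: memv_suml => u _; have [uA|uA] := boolP (u \in A).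
      by rewrite memvZ // memv_span // map_f // mem_enum.
    by rewrite v0 // scale0r mem0v.
  apply/span_subvP => v /mapP[u]; rewrite mem_enum => uA ->.
  apply/coord_spaceP => w wA; rewrite ffunE; case: eqP => // e.
  by rewrite e uA in wA.
have: free [seq delta u | u <- enum A].
  have := basis_free full.
  rewrite (perm_free (Y := map delta
    ([seq x <- enum I | x \in A] ++ [seq x <- enum I | x \notin A]))).
    by rewrite map_cat => /catl_free; rewrite enumT.
  by apply: perm_map; rewrite perm_sym perm_filterC.
by rewrite /free size_map -cardE => /eqP.
Qed.

Lemma clear_denominators v :
  exists N (w : I -> int), (0 < N)%N /\ forall u, v u *+ N = (w u)%:~R.
Proof.
pose d u := `|denq (v u)|%N.
have d0 u : (0 < d u)%N by rewrite absz_gt0 denq_neq0.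
exists (\prod_u d u)%N, (fun u => numq (v u) * (\prod_(w | w != u) d w)%N%:Z).
split=> [|u]; first by rewrite prodn_gt0.
rewrite (bigD1 u) //= mulrnA rmorphM /= -pmulrn -[LHS]mulr_natr; congr (_ * _).
rewrite numqE -[LHS]mulr_natr; congr (_ * _).
by rewrite /d natr_absz ger0_norm ?denq_ge0.
Qed.

End CoordSpace.

Section EulerPoincare.
Variables (G : graph) (n k : int).
Hypothesis hn : n <= 2.
Local Notation cochain := {ffun {set 'I_(ne G)} -> {mpoly int[nv G]}}.
Implicit Types (s : {set 'I_(ne G)}) (c : cochain).

(** A strict bound for the total degrees of all monomials that have degree [k]
    in some M_s, so that finitely many exponents suffice in degree [k]. *)
Definition mdeg_bound : nat :=
  (\sum_(s : {set 'I_(ne G)})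
    `|((ncomp s)%:Z * (n - 1) + #|s|%:Z - k)%R|%N)%N.+1.

Lemma mdeg_lt_bound s (m : 'X_{1..nv G}) :
  mon_degree n s m = k -> (mdeg m < mdeg_bound)%N.
Proof.
rewrite /mon_degree ltnS => mk; rewrite (bigD1 s) //=.
apply: leq_trans (leq_addr _ _).
by rewrite -mk opprD opprK addrC addrNK.
Qed.

Local Notation D := mdeg_bound.
Local Notation expo := {ffun 'I_(nv G) -> 'I_D}.
Local Notation idx := ({set 'I_(ne G)} * expo)%type.

Definition mon (f : expo) : 'X_{1..nv G} := [multinom (f z : nat) | z < nv G].

Lemma mon_inj : injective mon.
Proof.
move=> f g /mnmP e; apply/ffunP => z; apply/val_inj.
by have := e z; rewrite !mnmE.
Qed.

Lemma mon_surj (m : 'X_{1..nv G}) : (mdeg m < D)%N -> exists f, mon f = m.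
Proof.
move=> mD; exists [ffun z => inord (m z)]; apply/mnmP => z.
rewrite mnmE ffunE inordK //; apply: leq_ltn_trans mD.
by rewrite mdegE (bigD1 z) //= leq_addr.
Qed.

(** The coefficients of the monomials with all exponents below the bound; they
    determine the elements of [chain n i k] ([coords_chain_inj]).  The map is
    defined on all cochains so that additivity holds without side condition. *)
Definition coords c : {ffun idx -> rat^o} :=
  [ffun u => ((c u.1)@_(mon u.2))%:~R].

Fact coords_additive : zmod_morphism coords.
Proof. by move=> c c'; apply/ffunP => u; rewrite !ffunE mcoeffB rmorphB. Qed.
HB.instance Definition _ :=
  GRing.isZmodMorphism.Build _ _ coords coords_additive.

Definition basis i : {set idx} :=
  [set u : idx | [&& #|u.1| == i, supported_mon u.1 (mon u.2)
                & mon_degree n u.1 (mon u.2) == k]].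

Lemma chain_supp i c s (m : 'X_{1..nv G}) :
  c \in chain n i k -> (c s)@_m != 0 ->
  [&& #|s| == i, supported_mon s m & mon_degree n s m == k].
Proof.
move=> /forallP/(_ s); case: eqP => [_|_ /eqP ->]; last by rewrite mcoeff0 eqxx.
by rewrite -mcoeff_msupp => /allP; apply.
Qed.

Lemma coords_chain_inj i c : c \in chain n i k -> coords c = 0 -> c = 0.
Proof.
move=> hc c0; apply/ffunP => s; apply/mpolyP => m; rewrite ffunE mcoeff0.
apply/eqP; apply: contraT => cm.
have /and3P[_ _ /eqP/mdeg_lt_bound mD] := chain_supp hc cm.
have [f fm] := mon_surj mD; have /ffunP/(_ (s, f)) := c0.
by rewrite !ffunE fm /= => /eqP; rewrite intr_eq0 (negbTE cm).
Qed.

Definition monomial_chain (u : idx) : cochain :=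
  [ffun s => if s == u.1 then 'X_[mon u.2] else 0].

Lemma coords_monomial u w : coords (monomial_chain u) w = (w == u)%:R.
Proof.
rewrite !ffunE /= -pair_eqE /pair_eq /=.
case: eqP => //= _; last by rewrite mcoeff0.
by rewrite mcoeffX (inj_eq mon_inj) eq_sym; case: eqP.
Qed.

Lemma monomial_chain_in i u : u \in basis i -> monomial_chain u \in chain n i k.
Proof.
rewrite inE => /and3P[/eqP ui us uk]; apply/forallP => s; rewrite ffunE.
case: (s =P u.1) => [->|_]; last by rewrite rpred0 eqxx if_same.
by rewrite ui eqxx mon_vertex_module us.
Qed.

Lemma chain_expand i c : c \in chain n i k ->
  c = \sum_(u : idx) monomial_chain u *~ (c u.1)@_(mon u.2).
Proof.
move=> hc; apply/eqP; rewrite -subr_eq0; apply/eqP.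
apply: (@coords_chain_inj i).
  rewrite rpredB // rpred_sum // => u _; have [uB|uB] := boolP (u \in basis i).
    by rewrite rpredMz // monomial_chain_in.
  rewrite [_@__](_ : _ = 0) ?mulr0z ?rpred0 //; apply/eqP.
  by apply: contraNT uB => /(chain_supp hc); rewrite inE.
apply/ffunP => w; rewrite raddfB raddf_sum !ffunE sum_ffunE (bigD1 w) //=.
rewrite raddfMz big1 ?addr0 => [|u uw].
  rewrite ffunMzE coords_monomial eqxx subrr //.
by rewrite raddfMz ffunMzE coords_monomial eq_sym (negbTE uw) mul0rz.
Qed.

(** The linear extension of the differential of the monomials.  It agrees with
    the differential on the coordinates of chains, where the truncation in
    [coords] loses nothing ([coords_differential]). *)
Definition rat_differential (v : {ffun idx -> rat^o}) : {ffun idx -> rat^o} :=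
  \sum_u v u *: coords (differential n (monomial_chain u)).
Fact rat_differential_linear : linear rat_differential.
Proof.
move=> a v w; rewrite /rat_differential scaler_sumr -big_split /=.
by apply: eq_bigr => u _; rewrite !ffunE scalerDl scalerA.
Qed.
HB.instance Definition _ :=
  GRing.isLinear.Build _ _ _ _ rat_differential rat_differential_linear.

Lemma coords_differential i c : c \in chain n i k ->
  coords (differential n c) = rat_differential (coords c).
Proof.
move=> hc; rewrite {1}(chain_expand hc) !raddf_sum; apply: eq_bigr => u _.
by rewrite 2!raddfMz ffunE scaler_int.
Qed.

Lemma chain_span i : rational_span coords (chain n i k) (coord_space (basis i)).
Proof.
split=> [c hc|v /coord_spaceP v0].
  apply/coord_spaceP => u; rewrite ffunE inE => uB; apply/eqP.
  by rewrite intr_eq0; apply: contraNT uB => /(chain_supp hc).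
have [N [w [N0 vw]]] := clear_denominators v.
exists N, (\sum_u monomial_chain u *~ w u); split=> //.
  apply: rpred_sum => u _; have [uB|uB] := boolP (u \in basis i).
    by rewrite rpredMz // monomial_chain_in.
  have /eqP := vw u; rewrite v0 // mul0rn eq_sym intr_eq0 => /eqP ->.
  by rewrite mulr0z rpred0.
apply/ffunP => u; rewrite raddf_sum sum_ffunE ffunMnE vw (bigD1 u) //=.
rewrite raddfMz ffunMzE coords_monomial eqxx big1 ?addr0 // => x xu.
by rewrite raddfMz ffunMzE coords_monomial eq_sym (negbTE xu) mul0rz.
Qed.

Definition dQ := linfun rat_differential.
Definition cycle_space i := (coord_space (basis i) :&: lker dQ)%VS.
Definition boundary_space i :=
  if i is i'.+1 then (dQ @: coord_space (basis i'))%VS else 0%VS.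

Lemma cycle_span i : rational_span coords (cycles n i k) (cycle_space i).
Proof.
split=> [c /andP[hc /eqP dc]|v].
  rewrite memv_cap (proj1 (chain_span i)) // memv_ker lfunE /=.
  by rewrite -(coords_differential hc) dc raddf0.
move=> /memv_capP[vC]; rewrite memv_ker lfunE /= => /eqP dv.
have [N [c [N0 hc ce]]] := proj2 (chain_span i) v vC.
exists N, c; split=> //; apply/andP; split=> //; apply/eqP.
apply: (coords_chain_inj (differential_chain hn hc)).
by rewrite (coords_differential hc) ce raddfMn /= dv mul0rn.
Qed.

Definition cycle_coords i (z : Defs.cycle G n i k) := coords (cycle_val z).
Fact cycle_coords_additive i : zmod_morphism (@cycle_coords i).
Proof. by move=> z z'; rewrite /cycle_coords -raddfB. Qed.
HB.instance Definition _ i :=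
  GRing.isZmodMorphism.Build _ _ (@cycle_coords i) (@cycle_coords_additive i).

Lemma cycle_coords_inj i : injective (@cycle_coords i).
Proof.
move=> z z' e; apply/val_inj/eqP; rewrite -subr_eq0; apply/eqP.
have [/andP[hz _] /andP[hz' _]] := (cycleP z, cycleP z').
apply: (@coords_chain_inj i); first by rewrite rpredB.
by rewrite raddfB; apply/eqP; rewrite subr_eq0; apply/eqP.
Qed.

Lemma all_cycle_span i : rational_span (@cycle_coords i) predT (cycle_space i).
Proof.
split=> [z _|v /(proj2 (cycle_span i))[N [c [N0 hc ce]]]].
  exact/(proj1 (cycle_span i))/cycleP.
by exists N, (Cycle hc).
Qed.

(** Boundaries are cycles because the differential squares to 0; this is what
    makes every vector of the image come from [boundaries]. *)
Lemma boundary_span i :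
  rational_span (@cycle_coords i) (mem (@boundaries G n i k))
    (boundary_space i).
Proof.
case: i => [|i]; split.
- by move=> z /eqP ->; rewrite raddf0 mem0v.
- move=> v; rewrite memv0 => /eqP ->; exists 1%N, 0.
  by rewrite raddf0 mul0rn; split=> //; apply/eqP.
- move=> z /asboolP[b hb dz].
  rewrite /cycle_coords -dz (coords_differential hb).
  by rewrite -[rat_differential _]lfunE memv_img // (proj1 (chain_span i)).
move=> _ /memv_imgP[w wC ->].
have [N [b [N0 hb be]]] := proj2 (chain_span i) w wC.
have hdb : differential n b \in cycles n i.+1 k.
  by apply/andP; rewrite differential_chain // differential2.
exists N, (Cycle hdb); split=> //; first by apply/asboolP; exists b.
by rewrite /cycle_coords /= (coords_differential hb) be lfunE raddfMn.
Qed.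

Lemma homology_has_rank i :
  has_rank (homology G n i k) (\dim (cycle_space i) - \dim (boundary_space i)).
Proof.
exact: (quotient_has_rank (@cycle_coords_inj i) (all_cycle_span i)
                          (boundary_span i)).
Qed.

Lemma boundary_le_cycle i : (\dim (boundary_space i) <= \dim (cycle_space i))%N.
Proof.
exact/dimvS/(rational_span_sub (all_cycle_span i) (boundary_span i)).
Qed.

Lemma rank_nullity i :
  (\dim (cycle_space i) + \dim (boundary_space i.+1) = #|basis i|)%N.
Proof. by rewrite -dim_coord_space limg_ker_dim. Qed.

Lemma basis_gt i : (ne G < i)%N -> basis i = finset.set0.
Proof.
move=> h; apply/setP => u; rewrite !inE.
apply/negbTE/negP => /and3P[/eqP ui _ _].
by have := max_card (mem u.1); rewrite ui card_ord leqNgt h.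
Qed.

(** The boundary dimensions cancel in consecutive positions.  The last one is 0
    since there is no chain in a position above the number of edges. *)
Lemma euler_char_basis :
  euler_char G n k = \sum_(i < (ne G).+1) (-1) ^+ i * (#|basis i|)%:Z.
Proof.
pose b i : int := (\dim (boundary_space i))%:Z.
have telescope N : \sum_(i < N.+1) (-1) ^+ i * (#|basis i|%:Z) =
    \sum_(i < N.+1) (-1) ^+ i * qdim (homology G n i) k + (-1) ^+ N * b N.+1.
  have E i : #|basis i|%:Z = qdim (homology G n i) k + b i + b i.+1.
    rewrite /qdim (rankE (homology_has_rank i)) -rank_nullity /b.
    have := boundary_le_cycle i; lia.
  elim: N => [|N IHN]; rewrite [LHS]big_ord_recr [in RHS]big_ord_recr /= E.
    by rewrite !big_ord0 /b /= dimv0; ring.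
  by rewrite IHN exprS; ring.
rewrite telescope /euler_char [b _](_ : _ = 0) ?mulr0 ?addr0 //; congr Posz.
apply/eqP; rewrite -leqn0 -[leqRHS](_ : #|basis (ne G).+1| = 0%N).
  rewrite -rank_nullity.
  exact: leq_trans (boundary_le_cycle _) (leq_addr _ _).
by rewrite basis_gt ?cards0.
Qed.

End EulerPoincare.

(** * Counting monomials *)

Lemma qmul_seq (f g : qseries) k (r : seq int) : uniq r ->
  (forall i, f i != 0 -> g (k - i) != 0 -> i \in r) ->
  qmul f g k = \sum_(i <- r) f i * g (k - i).
Proof.
move=> r_uniq hr; rewrite /qmul -(fsbig_widen [set` r]) //; last first.
  move=> i [_ /negP ir] /=; apply/eqP; rewrite mulf_eq0.
  by apply: contraNT ir; rewrite negb_or => /andP[]; apply: hr.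
by rewrite -fsbig_seq.
Qed.

Lemma qmul_shift (f : qseries) a k :
  qmul (fun i => (i == a)%:R) f k = f (k - a).
Proof.
rewrite (qmul_seq (r := [:: a])) ?big_seq1 ?eqxx ?mul1r // => i.
by rewrite inE pnatr_eq0 eqb0 negbK.
Qed.

(** Multiplication by q shifts the coefficients. *)
Lemma qexp_qvar i : qexp qvar i = fun k => (k == i%:Z)%:R.
Proof.
elim: i => [|i IHi]; first by [].
apply/funext => k; rewrite -[qexp _ _]/(qmul qvar (qexp qvar i)) IHi.
by rewrite (qmul_shift _ 1) subr_eq -[in RHS]addn1 PoszD.
Qed.

Section GeometricPowers.
Variable n : int.
Local Notation w := (qn_over_q_sub1 n).

Lemma w_neq0 i : (w i != 0) = (i <= n - 1).
Proof. by rewrite pnatr_eq0 eqb0 negbK. Qed.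

Lemma qexp_w_eq0 j k : j%:Z * (n - 1) < k -> qexp w j k = 0.
Proof.
elim: j k => [|j IHj] k hk.
  by rewrite /qexp /= /qone; case: eqP hk => // ->; rewrite mul0r ltxx.
rewrite -[LHS]/(qmul w (qexp w j) k) (qmul_seq (r := [::])) ?big_nil // => i.
rewrite w_neq0 => hi; case: (ltP (j%:Z * (n - 1)) (k - i)) => [/IHj ->|hki _].
  by rewrite eqxx.
by move: hk; rewrite -addn1 PoszD mulrDl mul1r; lia.
Qed.

(** Truncated to the [D] exponents allowed for one variable; below degree [D],
    its powers have the coefficients of those of the full geometric series. *)
Definition geom D : {poly int} := \poly_(t < D) 1.

(** In the convolution of [w] with the previous power, the index i = n - 1 - t
    contributes only for 0 <= t <= d: [w] vanishes for negative t, and the power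
    vanishes above its leading degree. *)
Lemma qexp_w D j d : (d < D)%N ->
  qexp w j (j%:Z * (n - 1) - d%:Z) = ((geom D) ^+ j)`_d.
Proof.
elim: j d => [|j IHj] d dD.
  by rewrite expr0 coef1 mul0r sub0r /qexp /= /qone oppr_eq0.
rewrite -[LHS]/(qmul w (qexp w j) _) exprS coefM.
pose r := [seq n - 1 - t%:Z | t <- iota 0 d.+1].
rewrite (qmul_seq (r := r)).
- rewrite big_map -[iota 0 d.+1]/(index_iota 0 d.+1) big_mkord.
  apply: eq_bigr => t _; have td : (t <= d)%N by rewrite -ltnS.
  rewrite /geom coef_poly (leq_ltn_trans td dD) -IHj; last first.
    by rewrite (leq_ltn_trans (leq_subr _ _)).
  congr (_ * _); first by rewrite /qn_over_q_sub1 lerBlDr lerDl.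
  by congr (qexp _ _ _); rewrite -subzn // -addn1 PoszD; ring.
- by rewrite map_inj_uniq ?iota_uniq // => t t' /addrI/oppr_inj[].
move=> i; rewrite w_neq0 => hi hq.
have : j.+1%:Z * (n - 1) - d%:Z - i <= j%:Z * (n - 1).
  by rewrite leNgt; apply: contraNN hq => /qexp_w_eq0 ->.
rewrite -addn1 PoszD mulrDl mul1r => h.
apply/mapP; exists `|(n - 1 - i)%R|%N; last lia.
by rewrite mem_iota; lia.
Qed.

End GeometricPowers.

(** Expanding the product over the vertices of the sums of powers of the
    variable, with only the power 0 at the vertices outside [S], enumerates the
    exponent functions; the power of the variable records their sum. *)
Lemma card_exponents N D d (S : {set 'I_N}) :
  #|[set f : {ffun 'I_N -> 'I_D.+1} |
      [forall y, (f y != 0 :> nat) ==> (y \in S)] && (\sum_y f y == d)%N]|%:Z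
  = ((geom D.+1) ^+ #|S|)`_d.
Proof.
pose F (y : 'I_N) (t : 'I_D.+1) : {poly int} :=
  ((t != 0 :> nat) ==> (y \in S))%:R * 'X^t.
have -> : geom D.+1 ^+ #|S| = \prod_y \sum_t F y t.
  rewrite -prodr_const big_mkcond /=; apply: eq_bigr => y _; case: ifP => yS.
    rewrite /geom poly_def; apply: eq_bigr => t _.
    by rewrite /F yS implybT mul1r scale1r.
  rewrite (bigD1 ord0) //= big1 ?addr0 => [|t t0]; first by rewrite /F mul1r.
  rewrite /F yS implybF negbK -[_ == 0%N :> nat]/(t == ord0).
  by rewrite (negbTE t0) mul0r.
rewrite bigA_distr_bigA coef_sum /= -sum1_card -natz natr_sum big_mkcond /=.
apply: eq_bigr => f _; rewrite inE big_split /= -expr_sum.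
have -> : \prod_y (((f y != 0 :> nat) ==> (y \in S))%:R : {poly int}) =
    [forall y, (f y != 0 :> nat) ==> (y \in S)]%:R.
  case: forallP => [h|/forallP/forallPn[y hy]].
    by rewrite big1 // => y _; rewrite h.
  by rewrite (bigD1 y) //= (negbTE hy) mul0r.
case: [forall y, _] => /=; last by rewrite mul0r coef0.
by rewrite mul1r coefXn eq_sym; case: eqP.
Qed.

Section Count.
Variables (G : graph) (n k : int).
Implicit Types s : {set 'I_(ne G)}.

(** A monomial of degree [k] in M_s has total degree c (n - 1) + #|s| - k, where
    c is the number of components.  When this is negative there is no monomial,
    and [k - #|s|] exceeds the leading degree of the series. *)
Lemma card_vertex_module s :
  #|[set f | supported_mon s (@mon G n k f) &&
             (mon_degree n s (mon f) == k)]|%:Z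
  = qexp (qn_over_q_sub1 n) (ncomp s) (k - #|s|%:Z).
Proof.
have degE (f : {ffun 'I_(nv G) -> 'I_(mdeg_bound G n k)}) :
    (mon_degree n s (mon f) == k) =
    ((\sum_y f y)%N%:Z == (ncomp s)%:Z * (n - 1) + #|s|%:Z - k).
  rewrite /mon_degree mdegE.
  under eq_bigr do rewrite mnmE.
  by apply/eqP/eqP; lia.
have [e0|e0] := ltP ((ncomp s)%:Z * (n - 1) + #|s|%:Z - k) 0.
  rewrite qexp_w_eq0; last by lia.
  congr Posz; apply/eqP; rewrite cards_eq0; apply/eqP/setP => f.
  rewrite !inE degE.
  by apply/negbTE; rewrite negb_and orbC; apply/orP; left; apply/eqP; lia.
pose d := `|((ncomp s)%:Z * (n - 1) + #|s|%:Z - k)%R|%N.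
have dE : d%:Z = (ncomp s)%:Z * (n - 1) + #|s|%:Z - k by rewrite /d gez0_abs.
have dD : (d < mdeg_bound G n k)%N.
  by rewrite ltnS (bigD1 s) //= leq_addr.
have -> : k - #|s|%:Z = (ncomp s)%:Z * (n - 1) - d%:Z by rewrite dE; ring.
rewrite (qexp_w _ _ dD) ncompE -card_exponents; congr Posz.
apply: eq_card => f; rewrite !inE degE -dE; congr (_ && _).
by apply: eq_forallb => y; rewrite inE mnmE.
Qed.

End Count.

Lemma coef_dichromatic G i j : (dichromatic G)`_j`_i =
  \sum_(s : {set 'I_(ne G)}) (-1) ^+ #|s| * ((i == #|s|) && (j == ncomp s))%:R.
Proof.
rewrite /dichromatic !coef_sum; apply: eq_bigr => s _.
rewrite coefCM coefXn; case: (j == _); last by rewrite andbF !mulr0 coef0.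
rewrite andbT mulr1.
have -> : (-1) ^+ #|s| = ((-1) ^+ #|s|)%:P :> {poly int}.
  by rewrite polyC_exp polyCN.
by rewrite coefCM coefXn.
Qed.

Lemma sum_coef_widen (R V : nzRingType) (p : {poly R}) N (F : nat -> R -> V) :
  (size p <= N)%N -> (forall i, F i 0 = 0) ->
  \sum_(i < size p) F i p`_i = \sum_(i < N) F i p`_i.
Proof.
move=> pN F0; rewrite (big_ord_widen _ (fun i => F i p`_i) pN) big_mkcond /=.
by apply: eq_bigr => i _; case: ltnP => // /(nth_default 0) ->.
Qed.

Lemma dichromatic_specE G n k : dichromatic_spec G n k =
  \sum_(s : {set 'I_(ne G)})
     (-1) ^+ #|s| * qexp (qn_over_q_sub1 n) (ncomp s) (k - #|s|%:Z).
Proof.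
rewrite /dichromatic_spec /eval_series.
set P := dichromatic G.
set X := fun i j : nat => qmul (qexp qvar i) (qexp (qn_over_q_sub1 n) j) k.
have s_lt (s : {set 'I_(ne G)}) : (#|s| < (ne G).+1)%N.
  by rewrite ltnS -[leqRHS]card_ord max_card.
have c_lt (s : {set 'I_(ne G)}) : (ncomp s < (nv G).+1)%N.
  by rewrite ltnS ncompE -[leqRHS]card_ord max_card.
have sizeP_j j : (size (P`_j)%R <= (ne G).+1)%N.
  apply/leq_sizeP => i hi; rewrite coef_dichromatic big1 // => s _.
  by rewrite gtn_eqF ?mulr0 // (leq_trans (s_lt s)).
have sizeP : (size P <= (nv G).+1)%N.
  apply/leq_sizeP => j hj; apply/polyP => i; rewrite coef0 coef_dichromatic.
  rewrite big1 // => s _.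
  by rewrite andbC gtn_eqF ?mulr0 // (leq_trans (c_lt s)).
rewrite (sum_coef_widen (F := fun j (p : {poly int}) =>
  \sum_(i < size p) p`_i * X i j) sizeP); last first.
  by move=> j; rewrite size_poly0 big_ord0.
under eq_bigr => j _.
  rewrite (sum_coef_widen (F := fun i a => a * X i j) (sizeP_j j));
    last by move=> i; rewrite mul0r.
  under eq_bigr do rewrite coef_dichromatic mulr_suml.
  over.
under eq_bigr do rewrite exchange_big.
rewrite exchange_big; apply: eq_bigr => s _ /=.
(* Only the exponents of the term of [s] itself survive. *)
rewrite (bigD1 (Ordinal (c_lt s))) //= (bigD1 (Ordinal (s_lt s))) //=.
rewrite !eqxx mulr1.
rewrite [X in _ + X + _]big1 ?[X in _ + X]big1 ?addr0.
- by rewrite /X qexp_qvar qmul_shift.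
- move=> j /negbTE; rewrite -(inj_eq val_inj) /= => ->; rewrite big1 // => i _.
  by rewrite andbF mulr0 mul0r.
by move=> i /negbTE; rewrite -(inj_eq val_inj) /= => ->; rewrite mulr0 mul0r.
Qed.

(** The basis monomials of all positions are regrouped by the edge set; the
    position, hence the sign, is the size of the edge set. *)
Lemma euler_charE G (n k : int) : n <= 2 -> euler_char G n k =
  \sum_(s : {set 'I_(ne G)})
     (-1) ^+ #|s| * qexp (qn_over_q_sub1 n) (ncomp s) (k - #|s|%:Z).
Proof.
move=> hn; rewrite euler_char_basis //.
transitivity (\sum_(s : {set 'I_(ne G)})
  \sum_(f | supported_mon s (@mon G n k f) && (mon_degree n s (mon f) == k))
    (-1) ^+ #|s| : int).
  rewrite pair_big_dep /= (partition_big (fun u : {set 'I_(ne G)} * _ =>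
    inord #|u.1| : 'I_(ne G).+1) predT) //=.
  apply: eq_bigr => i _; rewrite -natz -sum1_card natr_sum mulr_sumr.
  apply: eq_big => [u|u]; rewrite inE; last first.
    by move=> /andP[/eqP -> _]; rewrite mulr1.
  have -> : (inord #|u.1| == i :> 'I_(ne G).+1) = (#|u.1| == i :> nat).
    by rewrite -val_eqE /= inordK // ltnS -[leqRHS]card_ord max_card.
  by rewrite andbC.
apply: eq_bigr => s _; rewrite -card_vertex_module sumr_const -natz mulr_natr.
by rewrite cardsE.
Qed.

Theorem theorem3 (G : graph) (n : int) (hn : n <= 2) :
  (forall (i : nat) (k : int), finite_rank (homology G n i k)) /\
  euler_char G n = dichromatic_spec G n.
Proof.
split=> [i k|]; first by eexists; apply: homology_has_rank.
by apply/funext => k; rewrite euler_charE // dichromatic_specE.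
Qed.
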